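(* Let $K_j$ be a square coarse element partitioned into a uniform $m\times m$ grid of square fine elements ($h_x=h_y$), let $W_h(K_j)$ be the space of functions on $K_j$ that are constant on each fine element, and let $\kappa$ be a positive function that is constant on each fine element of $K_j$. Let $\mathcal{T}$ be one of the following symmetry transformations of the $m\times m$ grid, acting on elementwise constant functions on $K_j$: row symmetry, column symmetry, principal diagonal symmetry, auxiliary diagonal symmetry. If the pair $(\lambda^k,\Phi_k)$ is a solution of the local spectral problem on $K_j$ based on $\kappa$ (with weight $\tilde\kappa=\kappa$), then $(\lambda^k,\mathcal{T}\Phi_k)$ is a solution of the local spectral problem based on $\mathcal{T}\kappa$ (with weight $\tilde\kappa=\mathcal{T}\kappa$).
   Context: Local spectral problem on $K_j$ based on a positive elementwise constant coefficient $\kappa$ (with $\tilde\kappa=\kappa$): find $\lambda\in\mathbb{R}$ and $\Phi_h\in W_h(K_j)$, $\Phi_h\neq 0$, such that $$\sum_{e\in\mathcal{E}^h(K_j)}\kappa_e\,[\![\Phi_h]\!]_e\,[\![w_h]\!]_e\,\frac{|e|^2}{h_xh_y}=\lambda\int_{K_j}\kappa\,\Phi_h\,w_h\,d\boldsymbol{x}\qquad\text{for all } w_h\in W_h(K_j).$$ Here $h_x,h_y$ are the side lengths of the fine elements; $\mathcal{E}^h(K_j)$ is the set of internal edges of the fine grid in $K_j$ (edges shared by two fine elements of $K_j$); $|e|$ is the length of $e$; for an edge $e$ with neighbouring fine elements on its negative and positive sides, on which $\kappa$ takes the values $\kappa_{e,-},\kappa_{e,+}$, the edge coefficient $\kappa_e$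 is given by $\kappa_e^{-1}=\tfrac12(\kappa_{e,+}^{-1}+\kappa_{e,-}^{-1})$; and $[\![w]\!]_e$ is the jump of the elementwise constant function $w$ across $e$ towards the positive direction (the positive coordinate direction normal to $e$). Symmetry transformations: each $\mathcal{T}$ is induced by a reflection $\sigma$ of the square $K_j$ onto itself, which permutes the fine elements, via $(\mathcal{T}w)(\boldsymbol{x})=w(\sigma^{-1}(\boldsymbol{x}))$. Row symmetry reverses the order of the rows of the grid (reflection in the horizontal midline), column symmetry reverses the order of the columns (reflection in the vertical midline), principal diagonal symmetry is reflection in the diagonal from the top-left to the bottom-right corner, and auxiliary diagonal symmetry is reflection in the diagonal from the bottom-left to the top-right corner. *)

(* Defs.v *)
From mathcomp Require Import all_boot all_order all_algebra.
From mathcomp Require Import all_classical all_reals all_analysis.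
From mathcomp Require Import ring lra.

Set Implicit Arguments.
Unset Strict Implicit.
Unset Printing Implicit Defensive.

Import Order.TTheory GRing.Theory Num.Theory.

Local Open Scope classical_set_scope.
Local Open Scope ring_scope.

(* The coarse element K_j, with bottom-left corner (gx0, gy0), cut into
   gm x gm fine elements of size ghx x ghy. The first coordinate is horizontal
   and the second one vertical, pointing upwards. *)
Record grid (R : realType) := Grid {
  gx0 : R;
  gy0 : R;
  ghx : R;
  ghy : R;
  gm : nat;
  ghx_gt0 : 0 < ghx;
  ghy_gt0 : 0 < ghy;
  gm_gt0 : (0 < gm)%N
}.

(* c = (i, j) is the element in the i-th column from the left and the j-th row
   from the bottom. *)
Notation elem_idx G := ('I_(gm G) * 'I_(gm G))%type.

(* An internal edge is encoded by the pair (E-, E+) of fine elements sharing it,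
   where E+ lies on the side of the positive coordinate direction normal to the
   edge. *)
Notation edge_idx G := (elem_idx G * elem_idx G)%type.

Section LocalSpectralProblem.
Context {R : realType}.
Implicit Types (G : grid R) (w kappa Phi : R * R -> R).

Definition left_side G : R := gx0 G.
Definition right_side G : R := gx0 G + (gm G)%:R * ghx G.
Definition bottom_side G : R := gy0 G.
Definition top_side G : R := gy0 G + (gm G)%:R * ghy G.

Definition coarse_element G : set (R * R) :=
  `[left_side G, right_side G] `*` `[bottom_side G, top_side G].

Definition fine_element G (c : elem_idx G) : set (R * R) :=
  `]gx0 G + c.1%:R * ghx G, gx0 G + c.1.+1%:R * ghx G[ `*`
  `]gy0 G + c.2%:R * ghy G, gy0 G + c.2.+1%:R * ghy G[.

Definition elem_center G (c : elem_idx G) : R * R :=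
  (gx0 G + (c.1%:R + 2^-1) * ghx G, gy0 G + (c.2%:R + 2^-1) * ghy G).

(* W_h(K_j). Elementwise constant functions are only determined off the
   grid lines; as fine elements are open, the representative which is zero on
   the grid lines (and outside K_j) is singled out, so that equality in W_h(K_j)
   is equality of functions and every reflection of K_j preserves the space. *)
Definition elementwise_constant G w : Prop :=
  (forall c : elem_idx G, exists a : R,
     forall x, fine_element c x -> w x = a) /\
  (forall x, (forall c : elem_idx G, ~ fine_element c x) -> w x = 0).

Definition positive_coefficient G kappa : Prop :=
  elementwise_constant G kappa /\
  (forall (c : elem_idx G) x, fine_element c x -> 0 < kappa x).

Definition elem_val G w (c : elem_idx G) : R := w (elem_center c).

Definition vertical_edge G (e : edge_idx G) : bool :=
  (e.2.1 == e.1.1.+1 :> nat) && (e.2.2 == e.1.2).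

Definition horizontal_edge G (e : edge_idx G) : bool :=
  (e.2.1 == e.1.1) && (e.2.2 == e.1.2.+1 :> nat).

Definition internal_edge G (e : edge_idx G) : bool :=
  vertical_edge e || horizontal_edge e.

Definition edge_length G (e : edge_idx G) : R :=
  if vertical_edge e then ghy G else ghx G.

Definition jump G w (e : edge_idx G) : R := elem_val w e.2 - elem_val w e.1.

Definition edge_coefficient G kappa (e : edge_idx G) : R :=
  (2^-1 * ((elem_val kappa e.2)^-1 + (elem_val kappa e.1)^-1))^-1.

Definition local_spectral_solution G kappa (lambda : R) Phi : Prop :=
  [/\ elementwise_constant G Phi,
      Phi <> cst 0 &
      forall w, elementwise_constant G w ->
        \sum_(e : edge_idx G | internal_edge e)
           edge_coefficient kappa e * jump Phi e * jump w e
             * (edge_length e ^+ 2 / (ghx G * ghy G)) =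
        lambda *
        \int[(@lebesgue_measure R \x @lebesgue_measure R)%E]_(x in coarse_element G)
           (kappa x * Phi x * w x)].

(* The orthogonal reflection in the line through p and q (for p <> q). *)
Definition line_reflection (p q x : R * R) : R * R :=
  let u := (q.1 - p.1, q.2 - p.2) in
  let t := ((x.1 - p.1) * u.1 + (x.2 - p.2) * u.2) / (u.1 ^+ 2 + u.2 ^+ 2) in
  (2 * (p.1 + t * u.1) - x.1, 2 * (p.2 + t * u.2) - x.2).

Lemma line_reflectionK p q : p <> q -> involutive (line_reflection p q).
Proof.
case: p q => [p1 p2] [q1 q2] npq [x1 x2].
have d0 : (q1 - p1) ^+ 2 + (q2 - p2) ^+ 2 != 0.
  apply/eqP => /eqP; rewrite paddr_eq0 ?sqr_ge0// !sqrf_eq0 !subr_eq0.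
  by move=> /andP[/eqP h1 /eqP h2]; apply: npq; rewrite h1 h2.
by rewrite /line_reflection /=; congr pair; field.
Qed.

Inductive symmetry : Set :=
  | row_symmetry
  | column_symmetry
  | principal_diagonal_symmetry
  | auxiliary_diagonal_symmetry.

Definition symmetry_axis G (s : symmetry) : (R * R) * (R * R) :=
  let xmid := 2^-1 * (left_side G + right_side G) in
  let ymid := 2^-1 * (bottom_side G + top_side G) in
  match s with
  | row_symmetry => ((left_side G, ymid), (right_side G, ymid))
  | column_symmetry => ((xmid, bottom_side G), (xmid, top_side G))
  | principal_diagonal_symmetry =>
      ((left_side G, top_side G), (right_side G, bottom_side G))
  | auxiliary_diagonal_symmetry =>
      ((left_side G, bottom_side G), (right_side G, top_side G))
  end.

Definition grid_reflection G (s : symmetry) : R * R -> R * R :=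
  line_reflection (symmetry_axis G s).1 (symmetry_axis G s).2.

Lemma grid_reflectionK G s : involutive (grid_reflection G s).
Proof.
have mx : 0 < (gm G)%:R * ghx G by rewrite mulr_gt0 ?ghx_gt0 ?ltr0n ?gm_gt0.
have my : 0 < (gm G)%:R * ghy G by rewrite mulr_gt0 ?ghy_gt0 ?ltr0n ?gm_gt0.
apply: line_reflectionK.
by case: s => /=; rewrite /left_side /right_side /bottom_side /top_side;
  case; lra.
Qed.

(* (T w)(x) = w(sigma^-1(x)), where sigma^-1 = sigma by grid_reflectionK. *)
Definition transform G (s : symmetry) w : R * R -> R :=
  fun x => w (grid_reflection G s x).

End LocalSpectralProblem.

(* Main.v *)
Require Import Defs.
From mathcomp Require Import all_boot all_order all_algebra.
From mathcomp Require Import all_classical all_reals all_analysis.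
From mathcomp Require Import measurable_realfun ring lra zify.

Import Order.TTheory GRing.Theory Num.Theory.
Local Open Scope ring_scope.

(** Each of the four reflections of the square permutes the fine elements by an
    involution of their indices, [reflect_idx] (lemma [fine_element_reflect]),
    so transforming an elementwise constant function only permutes its values
    ([elem_val_transform]).  The two sides of the spectral problem are finite
    sums over elements or pairs of neighbouring elements, and both are
    invariant under that permutation.

    - The integral of an elementwise constant function is the sum of its values
      times the area of a fine element ([Rintegral_elementwise_constant]), and
      permuting the elements permutes the terms ([Rintegral_transform]).

    - The edge sum is a sum over internal edges.  A reflection may exchange the
      negative and the positive side of an edge, and the diagonal ones exchange
      vertical and horizontal edges.  Neither matters: the harmonic mean of the
      coefficient is symmetric in the two sides, both jumps change sign
      together, and on a square grid the geometric weight of every edge is 1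
      ([edge_form_transform]).

    As the transformation is an involution of the space of elementwise constant
    functions, every test function for the transformed problem is the transform
    of a test function for the original one. *)

(** * Fine elements and integrals of elementwise constant functions *)

Section FineGrid.
Context {R : realType}.
Implicit Types (G : grid R) (f u v w : R * R -> R).

Lemma fine_elementP G (c : elem_idx G) (x : R * R) :
  fine_element c x <->
  (gx0 G + c.1%:R * ghx G < x.1 < gx0 G + c.1.+1%:R * ghx G) /\
  (gy0 G + c.2%:R * ghy G < x.2 < gy0 G + c.2.+1%:R * ghy G).
Proof. by rewrite /fine_element /= !in_itv. Qed.

Lemma elem_center_fine G (c : elem_idx G) : fine_element c (elem_center c).
Proof.
have hx := ghx_gt0 G; have hy := ghy_gt0 G.
by apply/fine_elementP => /=; rewrite -(natr1 c.1) -(natr1 c.2); split; lra.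
Qed.

Lemma open_cell_inj (a h t : R) (i j : nat) : 0 < h ->
  a + i%:R * h < t < a + i.+1%:R * h ->
  a + j%:R * h < t < a + j.+1%:R * h -> i = j.
Proof.
move=> h0 /andP[i1 i2] /andP[j1 j2].
have : (i%:R < j.+1%:R :> R) by rewrite -(ltr_pM2r h0); lra.
have : (j%:R < i.+1%:R :> R) by rewrite -(ltr_pM2r h0); lra.
by rewrite !ltr_nat; lia.
Qed.

Lemma fine_element_inj G (c d : elem_idx G) (x : R * R) :
  fine_element c x -> fine_element d x -> c = d.
Proof.
case: c d => [c1 c2] [d1 d2] /fine_elementP[/= h1 h2] /fine_elementP[/= k1 k2].
congr pair; apply: val_inj => /=.
- exact: open_cell_inj (ghx_gt0 G) h1 k1.
- exact: open_cell_inj (ghy_gt0 G) h2 k2.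
Qed.

Lemma elementwise_constantE G w (c : elem_idx G) (x : R * R) :
  elementwise_constant G w -> fine_element c x -> w x = elem_val w c.
Proof.
move=> [/(_ c)[a wa] _] cx.
by rewrite /elem_val (wa _ cx) (wa _ (elem_center_fine G c)).
Qed.

Lemma elementwise_constantM G u v : elementwise_constant G u ->
  elementwise_constant G v -> elementwise_constant G (fun x => u x * v x).
Proof.
move=> [cu u0] [cv v0]; split=> [c|x xG]; last by rewrite u0 ?mul0r.
have [[a ua] [b vb]] := (cu c, cv c).
by exists (a * b) => x cx; rewrite ua ?vb.
Qed.

(** An exact pointwise identity, not merely almost everywhere: on the grid lines
    and outside the coarse element both sides vanish. *)
Lemma elementwise_constant_sum G f : elementwise_constant G f ->
  f = fun x => \sum_(c : elem_idx G) elem_val f c * \1_(fine_element c) x.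
Proof.
move=> cf; apply/funext => x.
have [[c cx]|nx] := pselect (exists c : elem_idx G, fine_element c x).
- rewrite (bigD1 c)//= indicE mem_set// mulr1 big1 ?addr0.
    exact: elementwise_constantE.
  move=> d dc; rewrite indicE memNset ?mulr0// => dx.
  by move/eqP: dc; apply; exact: fine_element_inj dx cx.
- rewrite cf.2 => [|c cx]; last by apply: nx; exists c.
  rewrite big1// => c _; rewrite indicE memNset ?mulr0// => cx.
  by apply: nx; exists c.
Qed.

Let mu2 := (@lebesgue_measure R \x @lebesgue_measure R)%E.

Lemma measurable_fine_element G (c : elem_idx G) :
  measurable (fine_element c).
Proof. by apply: measurableX; exact: measurable_itv. Qed.

Lemma measurable_coarse_element G : measurable (coarse_element G).
Proof. by apply: measurableX; exact: measurable_itv. Qed.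

Lemma sub_fine_coarse G (c : elem_idx G) :
  (fine_element c `<=` coarse_element G)%classic.
Proof.
move=> x /fine_elementP[/andP[x1 x2] /andP[x3 x4]].
have hx := ghx_gt0 G; have hy := ghy_gt0 G.
have c1 : c.1.+1%:R * ghx G <= (gm G)%:R * ghx G.
  by rewrite ler_pM2r// ler_nat.
have c2 : c.2.+1%:R * ghy G <= (gm G)%:R * ghy G.
  by rewrite ler_pM2r// ler_nat.
have d1 : 0 <= c.1%:R * ghx G by rewrite mulr_ge0// ltW.
have d2 : 0 <= c.2%:R * ghy G by rewrite mulr_ge0// ltW.
rewrite /coarse_element /left_side /right_side /bottom_side /top_side.
by split => /=; rewrite in_itv /=; lra.
Qed.

Lemma measure_open_cell (a h : R) (i : nat) : 0 < h ->
  lebesgue_measure `]a + i%:R * h, a + i.+1%:R * h[%classic = h%:E.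
Proof.
move=> h0; rewrite lebesgue_measure_itv /= lte_fin -natr1 ifT; last lra.
by rewrite -EFinB; congr EFin; ring.
Qed.

Lemma measure_fine_element G (c : elem_idx G) :
  mu2 (fine_element c) = (ghx G * ghy G)%:E.
Proof.
rewrite EFinM -(measure_open_cell (gx0 G) _ c.1 (ghx_gt0 G)).
rewrite -(measure_open_cell (gy0 G) _ c.2 (ghy_gt0 G)).
by apply: product_measure1E; exact: measurable_itv.
Qed.

Lemma integral_fine_indic G (c : elem_idx G) :
  (\int[mu2]_(x in coarse_element G) (\1_(fine_element c) x)%:E =
   (ghx G * ghy G)%:E)%E.
Proof.
rewrite integral_indic; [|exact: measurable_coarse_element
  |exact: measurable_fine_element].
rewrite setIidl; [exact: measure_fine_element|exact: sub_fine_coarse].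
Qed.

(** Fine elements have finite area, which makes their indicators integrable and
    allows signed combinations of them to be integrated term by term. *)
Lemma integrable_fine_indic G (c : elem_idx G) :
  mu2.-integrable (coarse_element G) (fun x => (\1_(fine_element c) x)%:E).
Proof.
apply/integrableP; split.
  apply/measurable_EFinP; apply: measurable_funTS.
  by apply: measurable_indic; exact: measurable_fine_element.
under eq_integral do rewrite gee0_abs ?lee_fin//.
by rewrite integral_fine_indic ltry.
Qed.

Lemma Rintegral_elementwise_constant G f : elementwise_constant G f ->
  \int[mu2]_(x in coarse_element G) f x =
  \sum_(c : elem_idx G) elem_val f c * (ghx G * ghy G).
Proof.
move=> cf; rewrite /Rintegral {1}(elementwise_constant_sum _ _ cf).
under eq_integral do rewrite -sumEFin.
rewrite integral_sum; first last.
- move=> c; under eq_fun do rewrite EFinM.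
  apply: integrableZl; first exact: measurable_coarse_element.
  exact: integrable_fine_indic.
- exact: measurable_coarse_element.
transitivity (fine (\sum_(c : elem_idx G)
    (elem_val f c * (ghx G * ghy G))%:E)%E); last by rewrite sumEFin.
congr fine; apply: eq_bigr => c _.
under eq_integral do rewrite EFinM.
rewrite integralZl ?integral_fine_indic//.
- exact: measurable_coarse_element.
- exact: integrable_fine_indic.
Qed.

End FineGrid.

(** * Reflections of the square *)

Section Reflection.
Context {R : realType} (G : grid R) (square : ghx G = ghy G).
Implicit Types (s : symmetry) (c d : elem_idx G) (w kappa : R * R -> R).

(** The auxiliary diagonal is the line on which the row and column indices agree,
    so that its reflection swaps them; the principal diagonal runs downwards
    from the top left, which adds a reversal of both indices. *)
Definition reflect_idx s c : elem_idx G :=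
  match s with
  | row_symmetry => (c.1, rev_ord c.2)
  | column_symmetry => (rev_ord c.1, c.2)
  | principal_diagonal_symmetry => (rev_ord c.2, rev_ord c.1)
  | auxiliary_diagonal_symmetry => (c.2, c.1)
  end.

Lemma reflect_idxK s : involutive (reflect_idx s).
Proof. by case: s => -[i j]; rewrite /reflect_idx /= ?rev_ordK. Qed.

(** The reflections in coordinates.  The diagonals have slope 1 and -1 only
    because the coarse element is a square. *)
Lemma grid_reflectionE s (x : R * R) :
  grid_reflection G s x =
  match s with
  | row_symmetry => (x.1, bottom_side G + top_side G - x.2)
  | column_symmetry => (left_side G + right_side G - x.1, x.2)
  | principal_diagonal_symmetry =>
      (left_side G + (top_side G - x.2), top_side G - (x.1 - left_side G))
  | auxiliary_diagonal_symmetry =>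
      (left_side G + (x.2 - bottom_side G), bottom_side G + (x.1 - left_side G))
  end.
Proof.
have H2_gt0 : 0 < ((gm G)%:R * ghx G) ^+ 2.
  by rewrite exprn_gt0// mulr_gt0 ?ghx_gt0 ?ltr0n ?gm_gt0.
case: x => x y.
case: s; rewrite /grid_reflection /line_reflection /symmetry_axis
  /left_side /right_side /bottom_side /top_side -square /=; congr pair; field;
  by rewrite gt_eqF//; lra.
Qed.

Lemma natr_rev_ord (i : 'I_(gm G)) :
  (rev_ord i)%:R = (gm G)%:R - i%:R - 1 :> R.
Proof. by rewrite /= natrB// -natr1 opprD addrA. Qed.

(** This is the geometric heart: the permutation of the indices is the one
    that the reflection of the plane induces on the fine elements.  As both are
    involutions, the converse implication follows. *)
Lemma fine_element_reflect s c (x : R * R) :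
  fine_element c x -> fine_element (reflect_idx s c) (grid_reflection G s x).
Proof.
move=> /fine_elementP[x1 x2]; apply/fine_elementP; rewrite grid_reflectionE.
move: x1 x2; rewrite /left_side /right_side /bottom_side /top_side -square.
case: s; rewrite /reflect_idx /= -!natr1 ?natr_rev_ord;
  move=> /andP[? ?] /andP[? ?]; split; lra.
Qed.

Lemma transformK s : involutive (transform G s : (R * R -> R) -> _).
Proof. by move=> w; apply/funext => x; rewrite /transform grid_reflectionK. Qed.

Lemma transform_elementwise_constant s w :
  elementwise_constant G w -> elementwise_constant G (transform G s w).
Proof.
move=> [cw w0]; split=> [c|x xG].
- have [a wa] := cw (reflect_idx s c).
  by exists a => x /(fine_element_reflect s)/wa.
- apply: w0 => c /(fine_element_reflect s); rewrite grid_reflectionK.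
  exact: xG.
Qed.

Lemma elem_val_transform s w c : elementwise_constant G w ->
  elem_val (transform G s w) c = elem_val w (reflect_idx s c).
Proof.
move=> cw; rewrite {1}/elem_val /transform.
by apply: elementwise_constantE => //; apply/fine_element_reflect/elem_center_fine.
Qed.

Lemma transform_positive s kappa :
  positive_coefficient G kappa -> positive_coefficient G (transform G s kappa).
Proof.
move=> [ck pk]; split; first exact: transform_elementwise_constant.
by move=> c x /(fine_element_reflect s)/pk.
Qed.

(** * Invariance of the edge sum *)

(** Unoriented adjacency.  Unlike [internal_edge], which knows the positive
    side of an edge, this relation is preserved by reflections. *)
Definition adjacent (c d : elem_idx G) : bool :=
  internal_edge (c, d) || internal_edge (d, c).

Lemma adjacent_reflect s c d :
  adjacent (reflect_idx s c) (reflect_idx s d) = adjacent c d.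
Proof.
case: c d => [[i1 i1m] [i2 i2m]] [[j1 j1m] [j2 j2m]].
rewrite /adjacent /internal_edge /vertical_edge /horizontal_edge -!val_eqE /=.
by case: s => /=; lia.
Qed.

(** Two adjacent elements are the two sides of exactly one internal edge, in
    exactly one of the two orders; a summand that does not depend on the order
    is thus counted twice by the sum over adjacent ordered pairs.  This trades
    oriented edges for a relation with full symmetry. *)
Lemma sum_internal_edge (g : elem_idx G -> elem_idx G -> R) :
  (forall c d, g c d = g d c) ->
  2 * (\sum_(e : edge_idx G | internal_edge e) g e.1 e.2) =
  \sum_(e : edge_idx G | adjacent e.1 e.2) g e.1 e.2.
Proof.
move=> gC; rewrite mulr_natl mulr2n.
rewrite (bigID (@internal_edge _ G) (fun e => adjacent e.1 e.2)) /=.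
congr (_ + _).
- apply: eq_bigl => -[c d]; rewrite /adjacent /=.
  by case: internal_edge; rewrite ?andbF.
- pose swap (e : edge_idx G) : edge_idx G := (e.2, e.1).
  have swapK : involutive swap by case.
  rewrite (reindex_inj (inv_inj swapK)) /=; apply: eq_big => [[c d]|[c d] _] /=.
    (* No pair of elements is an internal edge in both orders. *)
    case: c d => [[i1 i1m] [i2 i2m]] [[j1 j1m] [j2 j2m]].
    rewrite /adjacent /internal_edge /vertical_edge /horizontal_edge -!val_eqE /=.
    by lia.
  exact: gC.
Qed.

Lemma sum_internal_edge_reflect s (g : elem_idx G -> elem_idx G -> R) :
  (forall c d, g c d = g d c) ->
  \sum_(e : edge_idx G | internal_edge e)
    g (reflect_idx s e.1) (reflect_idx s e.2) =
  \sum_(e : edge_idx G | internal_edge e) g e.1 e.2.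
Proof.
move=> gC; apply: (@mulfI _ 2); first by rewrite pnatr_eq0.
rewrite (sum_internal_edge
  (fun c d => g (reflect_idx s c) (reflect_idx s d)))//.
rewrite sum_internal_edge//.
pose refl (e : edge_idx G) : edge_idx G :=
  (reflect_idx s e.1, reflect_idx s e.2).
have reflK : involutive refl by case=> c d; rewrite /refl /= !reflect_idxK.
rewrite [RHS](reindex_inj (inv_inj reflK)) /=.
by apply: eq_bigl => e; rewrite adjacent_reflect.
Qed.

Definition edge_form kappa u v : R :=
  \sum_(e : edge_idx G | internal_edge e)
    edge_coefficient kappa e * jump u e * jump v e
      * (edge_length e ^+ 2 / (ghx G * ghy G)).

(** The left-hand side of the spectral problem is invariant.  The square shape
    enters through the weights: the diagonal reflections exchange vertical and
    horizontal edges, which have equal weights only if they are equally long. *)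
Lemma edge_form_transform s kappa u v :
  elementwise_constant G kappa -> elementwise_constant G u ->
  elementwise_constant G v ->
  edge_form (transform G s kappa) (transform G s u) (transform G s v) =
  edge_form kappa u v.
Proof.
move=> ck cu cv; have h0 : ghx G != 0 by rewrite gt_eqF// ghx_gt0.
pose g c d : R := edge_coefficient kappa (c, d) * jump u (c, d) * jump v (c, d).
have len (e : edge_idx G) : edge_length e ^+ 2 / (ghx G * ghy G) = 1.
  by rewrite /edge_length -square if_same expr2 divff// mulf_neq0.
have gC c d : g c d = g d c.
  by rewrite /g /edge_coefficient /jump /= (addrC _ (elem_val kappa c)^-1); ring.
rewrite /edge_form.
transitivity (\sum_(e : edge_idx G | internal_edge e) g e.1 e.2).
- rewrite -(sum_internal_edge_reflect s _ gC); apply: eq_bigr => e _.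
  by rewrite len mulr1 /g /edge_coefficient /jump !elem_val_transform.
- by apply: eq_bigr => -[c d] _; rewrite len mulr1.
Qed.

(** * Invariance of the integral and of the spectral problem *)

Lemma Rintegral_transform s f : elementwise_constant G f ->
  \int[(@lebesgue_measure R \x @lebesgue_measure R)%E]_(x in coarse_element G)
    transform G s f x =
  \int[(@lebesgue_measure R \x @lebesgue_measure R)%E]_(x in coarse_element G)
    f x.
Proof.
move=> cf; rewrite !Rintegral_elementwise_constant//; last first.
  exact: transform_elementwise_constant.
rewrite [RHS](reindex_inj (inv_inj (reflect_idxK s))).
by apply: eq_bigr => c _; rewrite elem_val_transform.
Qed.

End Reflection.

Theorem theorem3p4 (R : realType) (G : grid R) (square : ghx G = ghy G)
    (kappa : R * R -> R) (kappa_pos : positive_coefficient G kappa)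
    (s : symmetry) (lambda : R) (Phi : R * R -> R) :
  local_spectral_solution G kappa lambda Phi ->
  positive_coefficient G (transform G s kappa) /\
  local_spectral_solution G (transform G s kappa) lambda (transform G s Phi).
Proof.
move=> [cPhi Phi0 eqPhi]; have ck := kappa_pos.1.
split; first exact: transform_positive.
split; first exact: transform_elementwise_constant.
  move=> TPhi0; apply: Phi0.
  by rewrite -[Phi](transformK G s) TPhi0.
move=> w cw; have cTw := transform_elementwise_constant _ square s _ cw.
(* Tested with the transform of w, whose own transform is w again. *)
have := eqPhi _ cTw.
rewrite -/(edge_form _ _ _ _) -(edge_form_transform _ square s)// transformK.
rewrite /edge_form => ->; congr (lambda * _).
rewrite -(Rintegral_transform _ square s); first by rewrite /transform;
  under [LHS]eq_Rintegral do rewrite grid_reflectionK.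
by do 2 apply: elementwise_constantM => //.
Qed.
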